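(* Any three dimensional simplicial polyhedron, that is, a convex polyhedron in $\mathbb{R}^3$ all of whose faces have exactly three sides, is coherently labellable.
   Context: For a convex polyhedron, each face $F$ is oriented by the outward normal, so its boundary edges are traversed anticlockwise as seen from outside. A labelling of all the edges by integers is coherent if, for each face $F$ with $n_F$ edges, there is a choice of starting edge such that the successive labels read anticlockwise from that edge satisfy $a_1<a_2<\cdots<a_{n_F}$. The polyhedron is coherently labellable if it has a coherent labelling. *)

(* Defs.v *)
From mathcomp Require Import all_boot all_order all_algebra.
From mathcomp Require Import boolp classical_sets functions cardinality.
From mathcomp Require Import reals convex.

Set Implicit Arguments.
Unset Strict Implicit.
Unset Printing Implicit Defensive.

Import Order.TTheory GRing.Theory Num.Theory.
Local Open Scope classical_set_scope.
Local Open Scope ring_scope.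

Section Polyhedra.
Variable R : realType.
Local Notation point := 'rV[R]_3.

Definition convex_hull (A : set point) : set point := smallest (@convex_set R point) A.

(* x0 and the points x0 + row i M are d + 1 affinely independent points of A
   whose affine span contains A *)
Definition has_affine_dim (d : nat) (A : set point) : Prop :=
  exists (x0 : point) (M : 'M[R]_(d, 3)),
    [/\ row_free M, A x0, (forall i, A (x0 + row i M))
      & (forall x, A x -> (x - x0 <= M)%MS)].

Definition convex_polyhedron (P : set point) : Prop :=
  (exists2 A : set point, finite_set A & P = convex_hull A) /\
  has_affine_dim 3 P.

Definition dot (u v : point) : R := (u *m v^T) 0 0.

(* for n != 0, the intersection of P with its supporting plane of outward
   normal n *)
Definition support_face (P : set point) (n : point) : set point :=
  [set x | P x /\ forall y, P y -> dot n y <= dot n x].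

(* The direction n = 0 yields P itself, of dimension 3, so it contributes no
   face of dimension d < 3. *)
Definition face_of_dim (d : nat) (P F : set point) : Prop :=
  (exists n, F = support_face P n) /\ has_affine_dim d F.

Definition edge (P E : set point) : Prop := face_of_dim 1 P E.

Definition face (P F : set point) : Prop := face_of_dim 2 P F.

Definition edges_of_face (P F : set point) : set (set point) :=
  [set E | edge P E /\ E `<=` F].

(* For u orthogonal to n != 0, v -> triple n u v is positive exactly on the
   left of u, as seen from the side to which n points. *)
Definition triple (n u v : point) : R :=
  \det (\matrix_(i < 3) [:: n; u; v]`_i).

(* the closed circuit of oriented segments v_1 v_2, v_2 v_3, ..., v_k v_1 *)
Definition circuit (vs : seq point) : seq (point * point) :=
  zip vs (rot 1 vs).

Definition sides (vs : seq point) : seq (set point) :=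
  [seq convex_hull [set ab.1; ab.2] | ab <- circuit vs].

(* vs lists the vertices of the face F of P in the order in which they are met
   when the boundary of F is traversed once, with F on the left as seen from
   the side to which n points. *)
Definition anticlockwise (P F : set point) (n : point) (vs : seq point) : Prop :=
  [/\ uniq (sides vs), [set` sides vs] = edges_of_face P F
    & forall a b x, (a, b) \in circuit vs -> F x ->
        0 <= triple n (b - a) (x - a)].

(* Only the values of lab on the edges of P matter. The choice of the starting
   edge is the choice of the first vertex of vs. *)
Definition coherent (P : set point) (lab : set point -> int) : Prop :=
  forall (F : set point) (n : point), face P F -> F = support_face P n ->
  exists2 vs : seq point, anticlockwise P F n vs &
    sorted <%R [seq lab E | E <- sides vs].

Definition coherently_labellable (P : set point) : Prop :=
  exists lab : set point -> int, coherent P lab.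

Definition simplicial (P : set point) : Prop :=
  forall F, face P F -> (edges_of_face P F #= `I_3)%card.

End Polyhedra.

(* Main.v *)
Require Import Defs.
From mathcomp Require Import all_boot all_order all_algebra.
From mathcomp Require Import boolp classical_sets functions cardinality.
From mathcomp Require Import reals convex interval_inference.
From mathcomp Require Import ring lra.

(** Orient a triangular face anticlockwise and let [a], [b], [c] be its vertices
    in this order, [a] being the lowest for a generic linear functional [h].
    Its labels are coherent as soon as [c a < a b < b c].  This suggests to
    compare two edges first by the height of their lower end: then [b c] comes
    last, and only the comparison of the edges [a b] and [a c], which rise from
    the same vertex, remains to be arranged.

    Let [v0] and [v1] be the lowest and the highest vertices.  If [a] is not
    [v0], the edges that rise from [a] do not turn all the way around [a], and
    they are linearly ordered by the slope
      [det (b - a, v1 - a, v0 - a) / h (b - a)].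
    Indeed some positive combination [r] of the inward directions [v0 - a] and
    [v1 - a] is horizontal, and the sign of the difference of the slopes of [a b]
    and [a c] is that of the scalar product of [r] with the outward normal of the
    face, which is negative since [v0] is not in the face.  The computation is
    a Pluecker relation between four vectors of space ([triple_plucker],
    [slope_lt]).

    The edges at [v0] do turn all the way around, and their cyclic order has to
    be cut.  The functional [h] is chosen as a small perturbation of a functional
    [h0] that is minimal exactly on some edge [v0 w0]; hence [w0] is the second
    lowest vertex.  The edges at [v0] other than [v0 w0] are linearly ordered by
    the slope relative to [h0].  The edges at [v0] come before all the others,
    [v0 w0] being the first, with one exception.  In the face [v0 w0 c] that
    lies on the left of [v0 w0], the slopes are of no help, and the edge [w0 c]
    is inserted immediately after [v0 w0], so that [v0 w0 < w0 c < c v0].  This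
    does not disturb the other face at [w0 c], because [w0 c] was already the
    first of the edges that rise from [w0] ([triangle_labels]).

    That the faces are triangles with the expected sides is proved by gift
    wrapping: each vertex of a face is the start of a side that leaves the face
    on its left ([next_vertex]), and distinct vertices yield distinct sides, so
    a face with three edges has exactly three vertices, which are permuted
    cyclically ([simplicial_face_triangle]). *)

Set Implicit Arguments.
Unset Strict Implicit.
Unset Printing Implicit Defensive.

Import Order.TTheory GRing.Theory Num.Theory.
Local Open Scope classical_set_scope.
Local Open Scope ring_scope.

(** * Scalar and mixed products in coordinates *)

Section VectorAlgebra.
Variable R : realType.
Local Notation point := 'rV[R]_3.
Implicit Types (u v w n x y : point).

Local Notation i1 := (lift ord0 ord0 : 'I_3).
Local Notation i2 := (lift ord0 (lift ord0 ord0) : 'I_3).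

Lemma dotE u v :
  dot u v = u 0 0 * v 0 0 + u 0 i1 * v 0 i1 + u 0 i2 * v 0 i2.
Proof. by rewrite /dot mxE !big_ord_recl big_ord0 !mxE addr0 addrA. Qed.

Lemma row3P u v :
  u 0 0 = v 0 0 -> u 0 i1 = v 0 i1 -> u 0 i2 = v 0 i2 -> u = v.
Proof.
move=> e0 e1 e2; apply/rowP => i.
case: (unliftP ord0 i) => [j ->|-> //].
case: (unliftP ord0 j) => [k ->|-> //].
by case: (unliftP ord0 k) => [[]|->].
Qed.

(* Writing [u] and [v] as explicit rows lets the index computations of the
   Laplace expansion reduce. *)
Lemma tripleE n u v :
  triple n u v = n 0 0 * (u 0 i1 * v 0 i2 - u 0 i2 * v 0 i1)
    + n 0 i1 * (u 0 i2 * v 0 0 - u 0 0 * v 0 i2)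
    + n 0 i2 * (u 0 0 * v 0 i1 - u 0 i1 * v 0 0).
Proof.
have rowE w : w = \row_i [:: w 0 0; w 0 i1; w 0 i2]`_i.
  by apply: row3P; rewrite mxE.
rewrite /triple (expand_det_row _ ord0) !big_ord_recl big_ord0 /cofactor.
rewrite !(expand_det_row _ ord0) !big_ord_recl !big_ord0 /cofactor !det_mx11.
rewrite [in LHS](rowE n) [in LHS](rowE u) [in LHS](rowE v).
by rewrite !mxE /= /bump /=; ring.
Qed.

Lemma dotDl u v x : dot (u + v) x = dot u x + dot v x.
Proof. by rewrite !dotE !mxE; ring. Qed.

Lemma dotDr n x y : dot n (x + y) = dot n x + dot n y.
Proof. by rewrite !dotE !mxE; ring. Qed.

Lemma dotBr n x y : dot n (x - y) = dot n x - dot n y.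
Proof. by rewrite !dotE !mxE; ring. Qed.

Lemma dotZl n (k : R) x : dot (k *: n) x = k * dot n x.
Proof. by rewrite !dotE !mxE; ring. Qed.

Lemma dotZr n (k : R) x : dot n (k *: x) = k * dot n x.
Proof. by rewrite !dotE !mxE; ring. Qed.

Lemma dotNl n x : dot (- n) x = - dot n x.
Proof. by rewrite !dotE !mxE; ring. Qed.

Lemma dot0l x : dot 0 x = 0.
Proof. by rewrite !dotE !mxE; ring. Qed.

Lemma dot_gt0 u : u != 0 -> 0 < dot u u.
Proof.
move=> u0; rewrite lt_def; apply/andP; split; last first.
  by rewrite dotE !addr_ge0 // -expr2 sqr_ge0.
apply: contraNneq u0; rewrite dotE -!expr2 => u0; apply/eqP.
have := sqr_ge0 (u 0 0); have := sqr_ge0 (u 0 i1); have := sqr_ge0 (u 0 i2).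
move=> p2 p1 p0; apply: row3P; rewrite !mxE; apply/eqP; rewrite -sqrf_eq0;
  apply/eqP; lra.
Qed.

(** Expansion, along a row repeated twice, of a vanishing determinant of size
    four. *)
Lemma triple_plucker n a b c d :
  dot n a * triple b c d - dot n b * triple a c d
    + dot n c * triple a b d - dot n d * triple a b c = 0.
Proof. by rewrite !dotE !tripleE; ring. Qed.

(** The cross product of [n] and [u]. *)
Definition cross n u : point :=
  \row_i [:: n 0 i1 * u 0 i2 - n 0 i2 * u 0 i1;
             n 0 i2 * u 0 0 - n 0 0 * u 0 i2;
             n 0 0 * u 0 i1 - n 0 i1 * u 0 0]`_i.

Lemma dot_cross n u v : dot (cross n u) v = triple n u v.
Proof. by rewrite dotE tripleE !mxE /=; ring. Qed.

(** Two vectors of the plane orthogonal to [n] with vanishing mixed product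
    with [n] are collinear. *)
Lemma collinear_planar n u v : n != 0 -> dot n u = 0 -> dot n v = 0 ->
  triple n u v = 0 -> dot u u *: v = dot u v *: u.
Proof.
move=> /dot_gt0 n0 nu nv t0.
suff cuv w : triple w u v = 0.
  (* The coordinates of [dot u u *: v - dot u v *: u] are those of
     [cross u (cross v u)], up to sign. *)
  apply/eqP; rewrite -subr_eq0; apply/eqP/row3P; rewrite !mxE.
  - have := cuv (cross (delta_mx 0 0) u).
    by rewrite !dotE !tripleE !mxE /=; lra.
  - have := cuv (cross (delta_mx 0 i1) u).
    by rewrite !dotE !tripleE !mxE /=; lra.
  - have := cuv (cross (delta_mx 0 i2) u).
    by rewrite !dotE !tripleE !mxE /=; lra.
have := triple_plucker n n w u v; rewrite nu nv t0 => e.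
by apply: (mulfI (lt0r_neq0 n0)); lra.
Qed.

End VectorAlgebra.

(** * Convex hulls and linear functionals *)

Section ConvexHull.
Variable R : realType.
Local Notation point := 'rV[R]_3.
Implicit Types (n x y : point) (A S : set point).

(** Convexity, with the weight as a real number between 0 and 1. *)
Lemma convex_setP S : @convex_set R point S <->
  (forall x y (t : R), 0 <= t -> t <= 1 -> S x -> S y ->
     S (t *: x + (1 - t) *: y)).
Proof.
split=> [cS x y t t0 t1 Sx Sy|cS x y l].
  have := cS x y (Itv01 t0 t1); rewrite !inE => /(_ Sx Sy).
  by [].
rewrite !inE => Sx Sy; apply: cS => //.
Qed.

Lemma convex_hull_convex A : @convex_set R point (convex_hull A).
Proof.
apply/convex_setP => x y t t0 t1 Ax Ay S [cS AS].
by apply: (iffLR (convex_setP S) cS) => //; [apply: Ax|apply: Ay].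
Qed.

Lemma sub_convex_hull A : A `<=` convex_hull A.
Proof. exact: sub_gen_smallest. Qed.

Lemma convex_hull_sub A S : @convex_set R point S -> A `<=` S ->
  convex_hull A `<=` S.
Proof. exact: smallest_sub. Qed.

(** If the generators of a hull lie strictly below the level [c] of [n] or in a
    convex set [S] that does not exceed that level, then so do all points:
    the set of points with this property is itself convex. *)
Lemma convex_hull_top A S n c x : @convex_set R point S ->
  (forall y, S y -> dot n y <= c) ->
  (forall a, A a -> dot n a < c \/ S a) ->
  convex_hull A x -> c <= dot n x -> S x.
Proof.
move=> /convex_setP cS Sc AS Ax cx.
suff {cx} : dot n x < c \/ S x by case=> // /lt_geF; rewrite cx.
apply: (convex_hull_sub _ AS) Ax.
apply/convex_setP => {}x y t t0 t1.
have [->|tn0] := eqVneq t 0; first by rewrite scale0r add0r subr0 scale1r.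
have [->|tn1] := eqVneq t 1; first by rewrite subrr scale0r addr0 scale1r.
have tgt0 : 0 < t by rewrite lt_def tn0.
have tlt1 : 0 < 1 - t by rewrite subr_gt0 lt_def eq_sym tn1.
case=> hx [] hy; last by right; exact: cS.
- by left; rewrite dotDr !dotZr; nra.
- by left; rewrite dotDr !dotZr; have := Sc _ hy; nra.
- by left; rewrite dotDr !dotZr; have := Sc _ hx; nra.
Qed.

Lemma convex_halfspace n c : @convex_set R point [set x | dot n x <= c].
Proof. by apply/convex_setP => x y t t0 t1 /= hx hy; rewrite dotDr !dotZr; nra. Qed.

Lemma convex_hull_le A n c : (forall a, A a -> dot n a <= c) ->
  forall x, convex_hull A x -> dot n x <= c.
Proof. exact: (convex_hull_sub (@convex_halfspace n c)). Qed.

Lemma convex_support_face A n :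
  @convex_set R point (support_face (convex_hull A) n).
Proof.
apply/convex_setP => x y t t0 t1 [Px hx] [Py hy]; split.
  exact: (iffLR (convex_setP _) (@convex_hull_convex A)).
move=> z Pz; rewrite dotDr !dotZr.
by have := hx _ Pz; have := hy _ Pz; nra.
Qed.

End ConvexHull.

(** * Vertices and faces of the hull of a finite set *)

Section FinitePoints.
Variable R : realType.
Local Notation point := 'rV[R]_3.
Implicit Types (n v w x y : point) (s : seq point).

Lemma exists_argmax (T : eqType) (f : T -> R) (s : seq T) (x0 : T) : x0 \in s ->
  exists2 x : T, x \in s & forall y : T, y \in s -> f y <= f x.
Proof.
elim: s x0 => // a s IH x0 _; case: s IH => [_|b s IH].
  by exists a; rewrite ?mem_head // => y; rewrite inE => /eqP ->.
have [x xs xmax] := IH b (mem_head _ _); have [ax|xa] := leP (f a) (f x).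
  exists x; first by rewrite inE xs orbT.
  by move=> y; rewrite inE => /predU1P [->|/xmax].
exists a; rewrite ?mem_head // => y; rewrite inE => /predU1P [->//|/xmax yx].
exact: le_trans yx (ltW xa).
Qed.

(** For finitely many pairs [(p, q)], the positivity of [p] entails that of
    [p + e * q] for a common small positive [e]. *)
Lemma small_perturbation (l : seq (R * R)) : exists2 e : R, 0 < e &
  forall p, p \in l -> 0 < p.1 -> 0 < p.1 + e * p.2.
Proof.
(* The induction needs the conclusion for all smaller values of [e]. *)
suff [e e0 H] : exists2 e : R, 0 < e & forall d, 0 < d -> d <= e ->
    forall p, p \in l -> 0 < p.1 -> 0 < p.1 + d * p.2.
  by exists e => //; apply: H.
elim: l => [|[p q] l [e e0 IH]]; first by exists 1.
pose e1 := if 0 < p then p / (`|q| + 1) else 1.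
have q1 : 0 < `|q| + 1 by rewrite ltr_wpDl.
have e10 : 0 < e1 by rewrite /e1; case: ifP => // p0; rewrite divr_gt0.
exists (Num.min e e1); first by rewrite lt_min e0.
move=> d d0; rewrite le_min => /andP [de de1] r; rewrite inE => /predU1P [->|rl].
  move=> /= p0; move: de1; rewrite /e1 p0 ler_pdivlMr // => dp.
  have : - `|q| <= q by rewrite lerNl -normrN ler_norm.
  nra.
exact: IH.
Qed.

(** Adding a small multiple of [g] to [n] preserves the strict inequalities of
    [n] between the points of a finite set. *)
Lemma perturb_functional s n g : exists2 e : R, 0 < e &
  forall x y, x \in s -> y \in s -> dot n x < dot n y ->
    dot (n + e *: g) x < dot (n + e *: g) y.
Proof.
have [e e0 H] := small_perturbation
  [seq (dot n (p.2 - p.1), dot g (p.2 - p.1)) | p <- [seq (x, y) | x <- s, y <- s]].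
exists e => // x y xs ys xy; rewrite -subr_gt0 -dotBr dotDl dotZl.
have := H (dot n (y - x), dot g (y - x)).
rewrite /= [dot n _]dotBr subr_gt0; apply => //.
by apply/mapP; exists (x, y); rewrite ?dotBr //; apply: allpairs_f.
Qed.

(** Some vector is orthogonal to none of finitely many nonzero vectors. *)
Lemma generic_nonorthogonal (l : seq point) : exists g : point,
  forall d, d \in l -> d != 0 -> dot g d != 0.
Proof.
elim: l => [|d l [g IH]]; first by exists 0.
have [d0|d0] := eqVneq (dot g d) 0; last first.
  by exists g => x; rewrite inE => /predU1P [->//|/IH].
have [e e0 H] := small_perturbation (map (fun x => (dot g x, dot d x)) l
  ++ map (fun x => (- dot g x, - dot d x)) l).
exists (g + e *: d) => x; rewrite inE dotDl dotZl => /predU1P [-> /dot_gt0 dd|xl x0].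
  by rewrite d0 add0r; apply: lt0r_neq0; rewrite mulr_gt0.
have /lt_total/orP[gx|gx] := IH _ xl x0.
  have := H (- dot g x, - dot d x); rewrite mem_cat (map_f _ xl) orbT.
  by rewrite /= oppr_gt0 mulrN -opprD oppr_gt0 => /(_ isT gx) /ltr0_neq0.
have := H (dot g x, dot d x); rewrite mem_cat.
by rewrite (map_f (fun x => (dot g x, dot d x)) xl) => /(_ isT gx) /lt0r_neq0.
Qed.

Lemma generic_injective s : exists g : point,
  forall x y, x \in s -> y \in s -> dot g x = dot g y -> x = y.
Proof.
have [g H] := generic_nonorthogonal [seq x - y | x <- s, y <- s].
exists g => x y xs ys gxy; apply/eqP; rewrite -subr_eq0.
have xy : x - y \in [seq x - y | x <- s, y <- s] by apply: allpairs_f.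
by apply: contraTT isT => /(H _ xy); rewrite dotBr gxy subrr eqxx.
Qed.

(** A functional that is injective on [s] and refines the order of [n]. *)
Lemma generic_refinement s n : exists h : point,
  (forall x y, x \in s -> y \in s -> dot n x < dot n y -> dot h x < dot h y) /\
  (forall x y, x \in s -> y \in s -> dot h x = dot h y -> x = y).
Proof.
have [g ginj] := generic_injective s.
have [e e0 H] := perturb_functional s n g.
exists (n + e *: g); split=> // x y xs ys.
have [nxy|nxy|nxy] := ltgtP (dot n x) (dot n y).
- by move=> hxy; have := H _ _ xs ys nxy; rewrite hxy ltxx.
- by move=> hxy; have := H _ _ ys xs nxy; rewrite hxy ltxx.
rewrite !dotDl !dotZl nxy => /addrI/(mulfI (lt0r_neq0 e0)); exact: ginj.
Qed.

(** [v] is a vertex of the convex hull of [s]: the only point of [s] at which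
    some linear functional attains its maximum on [s]. *)
Definition exposed s v :=
  v \in s /\ exists m, forall x, x \in s -> x != v -> dot m x < dot m v.

(** A vertex that lies in the hull of some points of [s] is one of them. *)
Lemma exposed_hull s v (B : set point) : exposed s v ->
  (forall b, B b -> b \in s) -> convex_hull B v -> B v.
Proof.
move=> [vs [m mv]] Bs Bv.
suff : (B `&` [set v]) v by case.
apply: (@convex_hull_top R B _ m (dot m v)) => //.
- apply/convex_setP => x y t _ _ [Bx /= xv] [_ /= ->]; rewrite xv.
  by rewrite -scalerDl addrCA subrr addr0 scale1r; split=> //; rewrite -xv.
- by move=> x [_ ->].
- move=> b Bb; have [bv|bv] := eqVneq b v; [right|left; exact/mv/bv/Bs].
  by rewrite -bv.
Qed.

Section Face.
Variables (s : seq point) (F : set point) (n : point).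
Let P := convex_hull [set` s].
Hypothesis hF : F = support_face P n.

Lemma face_sub x : F x -> P x.
Proof. by rewrite hF => -[]. Qed.

Lemma face_le v x : F v -> P x -> dot n x <= dot n v.
Proof. by rewrite hF => -[_]; apply. Qed.

Lemma faceP v x : F v -> F x <-> P x /\ dot n x = dot n v.
Proof.
move=> Fv; split=> [Fx|[Px nxv]]; last first.
  by rewrite hF; split=> // y Py; rewrite nxv; exact: face_le.
split; first exact: face_sub.
by apply/le_anti/andP; split; apply: face_le => //; apply: face_sub.
Qed.

(** A nonempty face contains one of the generating points. *)
Lemma face_gen x : F x -> exists2 v, v \in s & F v.
Proof.
move=> Fx; have [[v vs Fv]|noF] := pselect (exists2 v, v \in s & F v).
  by exists v.
(* Otherwise [n] would be strictly smaller than [dot n x] on [s], hence at [x]. *)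
suff : (set0 : set point) x by [].
apply: (@convex_hull_top R [set` s] _ n (dot n x)) => //; last exact: face_sub.
move=> a /= sa; have Pa : P a by exact: sub_convex_hull.
left; rewrite lt_neqAle face_le // andbT; apply/eqP => nax; apply: noF.
by exists a => //; apply/(faceP _ Fx).
Qed.

(** A property of the points of [s] in a face, cut out by a convex set, extends
    to the whole face. *)
Lemma face_ind (S : set point) : @convex_set R point S ->
  (forall a, a \in s -> F a -> S a) -> forall x, F x -> S x.
Proof.
move=> cS FS x Fx; have Px := face_sub Fx.
suff : (F `&` S) x by case.
apply: (@convex_hull_top R [set` s] _ n (dot n x)) => //.
- apply/convex_setP => y z t t0 t1 [Fy Sy] [Fz Sz]; split.
    have := @convex_support_face R [set` s] n; rewrite -/P -hF.
    by move=> /convex_setP; apply.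
  exact: (iffLR (convex_setP S) cS).
- by move=> y [/face_sub Py _]; apply: face_le.
- move=> a /= sa; have [Fa|nFa] := pselect (F a); first by right; split=> //; exact: FS.
  left; rewrite lt_neqAle face_le ?andbT //; last exact: sub_convex_hull.
  apply/eqP => nax; apply: nFa; apply/(faceP _ Fx); split=> //.
  exact: sub_convex_hull.
Qed.

(** The only maximizer of some functional among the points of [s] in a face is
    a vertex: the functional breaks the ties between the maximizers of [n]. *)
Lemma exposed_in_face g v : v \in s -> F v ->
  (forall x, x \in s -> F x -> x != v -> dot g x < dot g v) -> exposed s v.
Proof.
move=> vs Fv gv; split=> //; have [e e0 H] := perturb_functional s n g.
exists (n + e *: g) => x xs xv; have Px : P x by exact: sub_convex_hull.
have [nx|nx] := ltP (dot n x) (dot n v); first exact: H.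
have nxv : dot n x = dot n v by apply/le_anti; rewrite nx face_le.
rewrite !dotDl !dotZl nxv ltrD2l ltr_pM2l //; apply: gv => //.
exact/(faceP _ Fv).
Qed.

Lemma face_exposed x : F x -> exists2 v, exposed s v & F v.
Proof.
case/face_gen => v0 v0s Fv0; have [g ginj] := generic_injective s.
have v0f : v0 \in [seq x <- s | `[<F x>]] by rewrite mem_filter v0s andbT; apply/asboolP.
have [v] := exists_argmax (dot g) v0f.
rewrite mem_filter => /andP [/asboolP Fv vs] vmax; exists v => //.
apply: (@exposed_in_face g) => // y ys Fy yv.
rewrite lt_neqAle vmax ?mem_filter ?ys ?andbT; last exact/asboolP.
by apply: contra_neq yv; apply: ginj.
Qed.

End Face.
End FinitePoints.

(** * Edges of a face *)

Section Faces.
Variable R : realType.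
Local Notation point := 'rV[R]_3.
Implicit Types (n v w x y : point) (s : seq point) (F P : set point).

(** A two-dimensional set is not contained in a line, here the line through [v]
    directed by [d]. *)
Lemma affine_dim2_not_collinear F v (d : point) : has_affine_dim 2 F ->
  ~ (forall x, F x -> exists c, x - v = c *: d).
Proof.
move=> [x0 [M [fM Fx0 FM _]]] Fline.
have [c0 hc0] := Fline _ Fx0.
have [c hc] := choice (fun i => Fline _ (FM i)).
have : (M <= d)%MS.
  apply/row_subP => i; apply/sub_rVP; exists (c i - c0).
  by rewrite scalerBl -hc -hc0 opprB addrA subrK addrC addKr.
by move/mxrankS; move: fM; rewrite /row_free rank_rV => /eqP ->; case: eqP.
Qed.

(** A three-dimensional set is not contained in a plane. *)
Lemma affine_dim3_not_planar P n c : has_affine_dim 3 P -> n != 0 ->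
  ~ (forall x, P x -> dot n x = c).
Proof.
move=> [x0 [M [fM Px0 PM _]]] n0 Pc.
have : M *m n^T = 0.
  apply/row_matrixP => i; rewrite row_mul row0; apply/rowP => j.
  rewrite !ord1 [RHS]mxE; have := Pc _ (PM i).
  rewrite -(Pc _ Px0) dotDr => /eqP; rewrite -subr_eq0 addrC addKr => /eqP e.
  have -> : (row i M *m n^T) 0 0 = dot (row i M) n by [].
  by rewrite -e !dotE; ring.
move/(congr1 (mulmx (invmx M))); rewrite mulKmx -?row_free_unit // mulmx0.
by move/eqP; rewrite trmx_eq0 (negPf n0).
Qed.

(** The direction 0 would yield the whole of [P], whose dimension is not 2. *)
Lemma face_normal_neq0 P F n : has_affine_dim 3 P -> has_affine_dim 2 F ->
  F = support_face P n -> n != 0.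
Proof.
move=> [x0 [M [fM Px0 PM _]]] [y0 [N [_ _ _ FN]]] hF.
apply/eqP => n0; have PF x : P x -> F x.
  by move=> Px; rewrite hF; split=> // y _; rewrite n0 !dot0l.
have : (M <= N)%MS.
  apply/row_subP => i.
  have -> : row i M = (x0 + row i M - y0) - (x0 - y0).
    by rewrite opprB addrA subrK addrC addKr.
  by apply: addmx_sub; rewrite ?eqmx_opp; apply/FN/PF.
move/mxrankS; move: fM; rewrite /row_free => /eqP ->.
by move/leq_trans => /(_ _ (rank_leq_row N)).
Qed.

Lemma triple_orthogonal n x y z : n != 0 ->
  dot n x = 0 -> dot n y = 0 -> dot n z = 0 -> triple x y z = 0.
Proof.
move=> /dot_gt0/lt0r_neq0 n0 nx ny nz; apply: (mulfI n0).
by have := triple_plucker n n x y z; rewrite nx ny nz; lra.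
Qed.

Lemma segmentP v w (t : R) : 0 <= t -> t <= 1 ->
  convex_hull [set v; w] (v + t *: (w - v)).
Proof.
move=> t0 t1; have -> : v + t *: (w - v) = t *: w + (1 - t) *: v.
  by apply/rowP => i; rewrite !mxE; ring.
apply: (iffLR (convex_setP _) (@convex_hull_convex R _)) => //.
  by apply: sub_convex_hull; right.
by apply: sub_convex_hull; left.
Qed.

(** The end [w] of a segment is its only point at which [g] is maximal. *)
Lemma segment_max v w g x : dot g v < dot g w -> convex_hull [set v; w] x ->
  dot g w <= dot g x -> x = w.
Proof.
move=> gvw Ex; suff H : convex_hull [set v; w] x -> dot g w <= dot g x -> [set w] x.
  exact: H.
apply: convex_hull_top.
- apply/convex_setP => {Ex}x y t _ _ -> ->.
  by rewrite -scalerDl addrCA subrr addr0 scale1r.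
- by move=> y ->.
- by move=> a [->|->]; [left|right].
Qed.

Lemma segment_sub_line v w x : convex_hull [set v; w] x ->
  exists c, x - v = c *: (w - v).
Proof.
apply: (@convex_hull_sub R _ [set x | exists c, x - v = c *: (w - v)]); last first.
  move=> y [->|->]; first by exists 0; rewrite subrr scale0r.
  by exists 1; rewrite scale1r.
apply/convex_setP => {}x y t _ _ [c hx] [d hy]; exists (t * c + (1 - t) * d).
rewrite [RHS]scalerDl -!scalerA -hx -hy.
by apply/rowP => i; rewrite !mxE; ring.
Qed.

Lemma segment_affine_dim1 v w : w != v ->
  has_affine_dim 1 (convex_hull [set v; w]).
Proof.
move=> wv; exists v, (w - v); split.
- by rewrite /row_free rank_rV subr_eq0 wv.
- by apply: sub_convex_hull; left.
- by move=> i; rewrite row_id addrC subrK; apply: sub_convex_hull; right.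
- by move=> x /segment_sub_line/sub_rVP.
Qed.

(** From a vertex of a face starts a side that leaves the face on its left.  It
    is found by gift wrapping: its direction minimizes a slope among the
    points of [s] in the face, and its end is the furthest such point. *)
Lemma next_vertex s F n v (P := convex_hull [set` s]) :
  F = support_face P n -> n != 0 -> has_affine_dim 2 F ->
  exposed s v -> F v ->
  exists w, [/\ exposed s w, F w, w != v, edge P (convex_hull [set v; w])
    & (forall x, F x -> 0 <= triple n (w - v) (x - v)) /\
      (forall x, x \in s -> F x -> triple n (w - v) (x - v) = 0 ->
         convex_hull [set v; w] x)].
Proof.
move=> hF n0 dimF exv Fv; have [vs [m mv]] := exv.
have nF x : F x -> dot n (x - v) = 0.
  by move=> /(iffLR (faceP hF x Fv)) [_ nx]; rewrite dotBr nx subrr.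
pose r x := dot m (v - x).
have r_gt0 x : x \in s -> x != v -> 0 < r x.
  by move=> xs xv; rewrite /r dotBr subr_gt0; apply: mv.
pose L := [seq x <- s | `[< F x >] && (x != v)].
have LP x : x \in L -> [/\ F x, x != v & x \in s].
  by rewrite mem_filter -andbA => /and3P [/asboolP].
have inL x : x \in s -> F x -> x != v -> x \in L.
  by move=> xs Fx xv; rewrite mem_filter xs xv !andbT; apply/asboolP.
have [x0 x0L] : exists x0, x0 \in L.
  apply: contrapT => L0; apply: (@affine_dim2_not_collinear F v 0 dimF) => x Fx.
  exists 0; suff -> : x = v by rewrite subrr scale0r.
  apply: (face_ind hF (S := [set v])) Fx => [|a sa Fa].
    apply/convex_setP => y z t _ _ -> ->.
    by rewrite -scalerDl addrCA subrr addr0 scale1r.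
  by apply/eqP/negPn/negP => av; apply: L0; exists a; apply: inL.
(* The direction [q] of one point of the face serves as origin for the slopes,
   whose denominators [r x] are positive as [v] is exposed by [m].  The point
   [w] minimizes the slope, and is the furthest from [v] among the minimizers. *)
pose q := x0 - v; pose sl x := triple n q (x - v) / r x.
have [w1 w1L w1min] := exists_argmax (fun x => - sl x) x0L.
have w1L2 : w1 \in [seq x <- L | sl x == sl w1] by rewrite mem_filter eqxx.
have [w] := exists_argmax r w1L2; rewrite mem_filter => /andP [/eqP slw wL] wmax.
have [Fw wv ws] := LP _ wL; have [Fx0 x0v x0s] := LP _ x0L.
pose W := w - v.
have tripleW x : x \in L ->
    r x0 * triple n W (x - v) = r w * r x * (sl x - sl w).
  move=> xL; have [Fx xv xs] := LP _ xL.
  have rx := lt0r_neq0 (r_gt0 _ xs xv); have rw := lt0r_neq0 (r_gt0 _ ws wv).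
  have -> : r w * r x * (sl x - sl w)
      = r w * triple n q (x - v) - r x * triple n q W.
    by rewrite /sl -/W; field; rewrite rx rw.
  have := triple_plucker m n q W (x - v).
  rewrite (@triple_orthogonal n q W (x - v)) ?nF // /q /W /r !dotBr.
  by move=> e; lra.
have W_ge0 x : x \in s -> F x -> 0 <= triple n W (x - v).
  move=> xs Fx; have [->|xv] := eqVneq x v.
    by rewrite !tripleE !mxE; lra.
  have xL := inL _ xs Fx xv.
  rewrite -(pmulr_rge0 _ (r_gt0 _ x0s x0v)) tripleW // mulr_ge0 //.
    by rewrite mulr_ge0 // ltW // r_gt0.
  by rewrite subr_ge0 slw -lerN2; apply: w1min.
have W_eq0 x : x \in s -> F x -> triple n W (x - v) = 0 ->
    convex_hull [set v; w] x.
  move=> xs Fx T0; have [->|xv] := eqVneq x v.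
    by apply: sub_convex_hull; left.
  have xL := inL _ xs Fx xv; have := tripleW _ xL; rewrite T0 mulr0.
  move/esym/eqP; rewrite !mulf_eq0 (gt_eqF (r_gt0 _ ws wv)).
  rewrite (gt_eqF (r_gt0 _ xs xv)) /= subr_eq0 => /eqP slx.
  have rxw : r x <= r w by apply: wmax; rewrite mem_filter xL slx slw eqxx.
  have := collinear_planar n0 (nF _ Fw) (nF _ Fx) T0.
  have W0 : W != 0 by rewrite subr_eq0.
  have WW := dot_gt0 W0; rewrite -/W => cW.
  pose t := dot W (x - v) / dot W W.
  have xt : x - v = t *: W.
    apply: (scalerI (lt0r_neq0 WW)).
    by rewrite cW scalerA /t mulrCA mulfV ?mulr1 ?lt0r_neq0.
  have rt : r x = t * r w.
    by rewrite /r -opprB -[v - w]opprB xt -scaleN1r dotZr dotZr -scaleN1r dotZr; ring.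
  have rw := r_gt0 _ ws wv; have rx := r_gt0 _ xs xv.
  rewrite -[x](subrK v) addrC xt; apply: segmentP; move: rt rxw rw rx; nra.
have W_F x : F x -> 0 <= triple n W (x - v).
  move=> Fx; have := face_ind hF (@convex_halfspace R (- cross n W) (dot (- cross n W) v)).
  move/(_ _ x Fx) => /= H.
  have triE y : triple n W (y - v) = dot (- cross n W) v - dot (- cross n W) y.
    by rewrite !dotNl -dot_cross dotBr; ring.
  by rewrite triE subr_ge0; apply: H => a sa Fa; rewrite -subr_ge0 -triE W_ge0.
(* Tilting the supporting plane slightly around the line [v w] exposes the
   edge. *)
have [e e0 pert] := perturb_functional s n (- cross n W).
pose N := n + e *: - cross n W.
have NE y : F y -> dot N y = dot N v - e * triple n W (y - v).
  move=> /nF; rewrite dotBr => ny; rewrite /N !dotDl !dotZl !dotNl !dot_cross.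
  by rewrite (_ : triple n W (y - v) = triple n W y - triple n W v) -?dot_cross ?dotBr; lra.
have Nw : dot N w = dot N v by rewrite NE // -/W !tripleE; lra.
have Ns a : a \in s -> dot N a < dot N v \/ convex_hull [set v; w] a.
  move=> sa; have Pa : P a by apply: sub_convex_hull.
  have [na|na] := ltP (dot n a) (dot n v); first by left; apply: pert.
  have Fa : F a.
    by apply/(faceP hF _ Fv); split=> //; apply/le_anti; rewrite na (face_le hF).
  have [T0|T0] := eqVneq (triple n W (a - v)) 0; first by right; apply: W_eq0.
  by left; rewrite NE // ltrBlDr ltrDl mulr_gt0 // lt_def T0 W_ge0.
have hullN x : convex_hull [set v; w] x -> dot N x <= dot N v.
  by apply: convex_hull_le => a [->|->] //; rewrite Nw.
have hvw : convex_hull [set v; w] = support_face P N.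
  apply/seteqP; split=> x.
    apply: convex_hull_sub; first exact: convex_support_face.
    have NP y : P y -> dot N y <= dot N v.
      by apply: convex_hull_le => a /= sa; have [/ltW//|/hullN] := Ns _ sa.
    by move=> y [->|->]; split; rewrite ?Nw //; apply: sub_convex_hull.
  move=> [Px Nx]; apply: (@convex_hull_top R [set` s] _ N (dot N v)) => //.
    exact: convex_hull_convex.
  by apply: Nx; apply: sub_convex_hull.
exists w; split=> //.
- apply: (exposed_in_face hvw (g := W)) => //.
    by apply: sub_convex_hull; right.
  move=> x xs Ex xw; rewrite ltNge; apply: contra xw => xw.
  apply/eqP; apply: segment_max Ex xw.
  by rewrite -subr_gt0 -dotBr dot_gt0 // subr_eq0.
- by split; [exists N | exact: segment_affine_dim1].
Qed.

End Faces.

(** * Triangular faces *)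

Section Triangles.
Variable R : realType.
Local Notation point := 'rV[R]_3.
Implicit Types (n v w x y : point) (s : seq point) (F P : set point).

(** Three distinct elements exhaust a set of cardinality three. *)
Lemma card3_exhaust (T : Type) (E : set T) (e1 e2 e3 : T) :
  (E #= `I_3)%card -> E e1 -> E e2 -> E e3 -> e1 <> e2 -> e1 <> e3 -> e2 <> e3 ->
  forall e, E e -> [\/ e = e1, e = e2 | e = e3].
Proof.
move=> /card_set_bijP [f [fE finj _]] E1 E2 E3 n12 n13 n23 e Ee.
have {}finj (y z : T) : E y -> E z -> f y = f z -> y = z.
  by move=> Ey Ez; apply: finj; rewrite inE.
have fne (y z : T) : E y -> E z -> y <> z -> f y <> f z.
  by move=> Ey Ez yz /finj yz'; apply/yz/yz'.
have := fne _ _ E1 E2 n12; have := fne _ _ E1 E3 n13; have := fne _ _ E2 E3 n23.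
have := fE _ E1; have := fE _ E2; have := fE _ E3; have := fE _ Ee.
move=> l0 l3 l2 l1 m23 m13 m12.
have : [\/ f e = f e1, f e = f e2 | f e = f e3].
  move: (f e) (f e1) (f e2) (f e3) l0 l3 l2 l1 m23 m13 m12.
  by do 4! [case=> [|[|[|?]]] //] => *; do ?[by constructor].
by case=> [/finj|/finj|/finj] H; [constructor 1|constructor 2|constructor 3]; apply: H.
Qed.

(** [F] is a triangular face with vertices [a], [b], [c], met in this order when
    its boundary is traversed anticlockwise, seen from the side to which [n]
    points. *)
Definition triangle s F n (a b c : point) : Prop :=
  [/\ [/\ exposed s a, exposed s b & exposed s c],
      [/\ F a, F b & F c],
      0 < triple n (b - a) (c - a),
      anticlockwise (convex_hull [set` s]) F n [:: a; b; c]
    & forall x, exposed s x -> F x -> x \in [:: a; b; c]].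

Lemma triangle_rot s F n (a b c : point) :
  triangle s F n a b c -> triangle s F n b c a.
Proof.
case=> [[ea eb ec] [Fa Fb Fc] tgt0 [us es ls] ex]; split=> //.
- by rewrite (_ : triple _ _ _ = triple n (b - a) (c - a)) // !tripleE !mxE; ring.
- have rot_sides : sides [:: b; c; a] = rot 1 (sides [:: a; b; c]) by [].
  split.
  + by rewrite rot_sides rot_uniq.
  + by rewrite -es rot_sides; apply/seteqP; split=> E /=; rewrite mem_rot.
  + move=> x y z xy; apply: ls; rewrite -(mem_rot 1); exact: xy.
- by move=> x ex' Fx; have := ex x ex' Fx; rewrite -(mem_rot 1).
Qed.

Lemma simplicial_face_triangle s F n (P := convex_hull [set` s]) :
  F = support_face P n -> n != 0 -> has_affine_dim 2 F ->
  (edges_of_face P F #= `I_3)%card -> exists a b c, triangle s F n a b c.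
Proof.
move=> hF n0 dimF card3.
pose next v w := [/\ exposed s w, F w, w != v, edge P (convex_hull [set v; w])
    & (forall x, F x -> 0 <= triple n (w - v) (x - v)) /\
      (forall x, x \in s -> F x -> triple n (w - v) (x - v) = 0 ->
         convex_hull [set v; w] x)].
have nextP v : exposed s v -> F v -> exists w, next v w.
  exact: (next_vertex hF n0 dimF).
have es v : exposed s v -> v \in s by case.
have set2s v w : exposed s v -> exposed s w ->
    forall b, [set v; w] b -> b \in s.
  by move=> /es vs /es ws b [->|->].
have hullL v w : convex_hull [set v; w] v by apply: sub_convex_hull; left.
have hullR v w : convex_hull [set v; w] w by apply: sub_convex_hull; right.
have next_inj v w v' w' : exposed s v -> F v -> next v w ->
    exposed s v' -> next v' w' ->
    convex_hull [set v; w] = convex_hull [set v'; w'] -> v = v'.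
  move=> ev Fv [ew Fw wv _ [lw _]] ev' [ew' _ _ _ [lw' _]] eqE.
  (* Equal sides with distinct starts would be opposite, and the face would lie
     on both sides of their line. *)
  have [//|vw'] : [set v'; w'] v.
    by apply: (exposed_hull ev); [exact: set2s|rewrite -eqE].
  have [->//|v'w] : [set v; w] v'.
    by apply: (exposed_hull ev'); [exact: set2s|rewrite eqE].
  exfalso; apply: (@affine_dim2_not_collinear _ F v (w - v) dimF) => x Fx.
  have perp y : F y -> dot n (y - v) = 0.
    by move=> /(iffLR (faceP hF y Fv)) [_ ny]; rewrite dotBr ny subrr.
  have T0 : triple n (w - v) (x - v) = 0.
    have := lw' _ Fx; have := lw _ Fx; rewrite -vw' v'w.
    by rewrite !tripleE !mxE; lra.
  have W0 : w - v != 0 by rewrite subr_eq0.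
  have WW := lt0r_neq0 (dot_gt0 W0).
  exists (dot (w - v) (x - v) / dot (w - v) (w - v)); apply: (scalerI WW).
  rewrite (collinear_planar n0 (perp _ Fw) (perp _ Fx) T0) scalerA.
  by rewrite mulrCA mulfV ?mulr1.
have cF v w : F v -> next v w -> edges_of_face P F (convex_hull [set v; w]).
  move=> Fv [_ Fw _ Evw _]; split=> //; apply: convex_hull_sub.
    by rewrite hF; apply: convex_support_face.
  by move=> x [->|->].
have [x0 Fx0] : exists x, F x by case: dimF => x0 [M [_ Fx0 _ _]]; exists x0.
have [a ea Fa] := face_exposed hF Fx0.
have [b nab] := nextP _ ea Fa; have [eb Fb ba _ _] := nab.
have [c nbc] := nextP _ eb Fb; have [ec Fc cb _ _] := nbc.
have [d ncd] := nextP _ ec Fc; have [ed Fd dc _ _] := ncd.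
(* The successor of the successor of a vertex is not that vertex. *)
have no2 v w x : exposed s v -> F v -> next v w -> next w x -> x <> v.
  move=> ev Fv nvw nwx xv; have [ew Fw wv _ _] := nvw; rewrite xv in nwx.
  have := next_inj _ _ _ _ ev Fv nvw ew nwx.
  by rewrite setUC => /(_ erefl) /esym/eqP; rewrite (negPf wv).
have ca := no2 _ _ _ ea Fa nab nbc; have db := no2 _ _ _ eb Fb nbc ncd.
have E12 : convex_hull [set a; b] <> convex_hull [set b; c].
  by move/(next_inj _ _ _ _ ea Fa nab eb nbc)/esym/eqP; rewrite (negPf ba).
have E13 : convex_hull [set a; b] <> convex_hull [set c; d].
  by move/(next_inj _ _ _ _ ea Fa nab ec ncd)/esym.
have E23 : convex_hull [set b; c] <> convex_hull [set c; d].
  by move/(next_inj _ _ _ _ eb Fb nbc ec ncd)/esym/eqP; rewrite (negPf cb).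
have exh := card3_exhaust card3 (cF _ _ Fa nab) (cF _ _ Fb nbc) (cF _ _ Fc ncd)
  E12 E13 E23.
(* Any vertex of the face is the start of one of the three sides found. *)
have exF x : exposed s x -> F x -> [\/ x = a, x = b | x = c].
  move=> exx Fx; have [y nxy] := nextP _ exx Fx.
  have side_inj := next_inj _ _ _ _ exx Fx nxy.
  case: (exh _ (cF _ _ Fx nxy)).
  - by move/(side_inj _ _ ea nab) => ->; constructor 1.
  - by move/(side_inj _ _ eb nbc) => ->; constructor 2.
  - by move/(side_inj _ _ ec ncd) => ->; constructor 3.
have da : d = a by case: (exF _ ed Fd) => // /eqP; rewrite ?(negPf dc) //; move/eqP.
rewrite {}da in ncd E12 E13 E23 exh.
exists a, b, c; split=> //.
- have [_ _ _ _ [T_ge0 T_eq0]] := nab.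
  rewrite lt_def T_ge0 // andbT; apply/eqP => T0.
  have [//|] := exposed_hull ec (set2s _ _ ea eb) (T_eq0 _ (es _ ec) Fc T0).
  by move/eqP; rewrite (negPf cb).
- split.
  + rewrite /sides /= !inE negb_or andbT -andbA; apply/and3P; split; exact/eqP.
  + apply/seteqP; split=> E /=; rewrite /sides /= !inE.
      by case/or3P => /eqP ->; apply: cF.
    case/exh.
    * by move=> ->; rewrite eqxx.
    * by move=> ->; rewrite eqxx orbT.
    * by move=> ->; rewrite eqxx !orbT.
  + move=> x y z; rewrite /circuit /= !inE => + Fz.
    case/or3P => /eqP [-> ->].
    * by case: nab => _ _ _ _ [+ _]; apply.
    * by case: nbc => _ _ _ _ [+ _]; apply.
    * by case: ncd => _ _ _ _ [+ _]; apply.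
- by move=> x exx /(exF _ exx) [->|->|->]; rewrite !inE eqxx ?orbT.
Qed.

End Triangles.

(** * The labelling *)

(** Counting the smaller elements of a list turns the order of a totally ordered
    type into that of the natural numbers. *)
Lemma count_lt_rank (d : Order.disp_t) (T : orderType d) (l : seq T) (x y : T) :
  x \in l -> (x < y)%O ->
  (count (fun z => (z < x)%O) l < count (fun z => (z < y)%O) l)%N.
Proof.
move=> xl xy; rewrite !(permP (perm_to_rem xl)) /= ltxx xy add0n add1n ltnS.
by apply: sub_count => z zx; exact: lt_trans zx xy.
Qed.

Lemma sorted_sides3 (R : realType) (lab : set 'rV[R]_3 -> int) (x y z : 'rV[R]_3) :
  lab (convex_hull [set x; y]) < lab (convex_hull [set y; z]) ->
  lab (convex_hull [set y; z]) < lab (convex_hull [set z; x]) ->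
  sorted <%R [seq lab E | E <- sides [:: x; y; z]].
Proof. by move=> /= -> ->. Qed.

Section Labelling.
Variable R : realType.
Local Notation point := 'rV[R]_3.

(** The functionals [h] and [h0] are represented by vectors.  The points [v0],
    [w0] and [v1] are meant to be the lowest vertex, the second lowest vertex and
    a highest point of [s]; see the hypotheses stated below. *)
Variables (s : seq point) (h h0 v0 w0 v1 : point).
Let P := convex_hull [set` s].

(** The plane through [v0], [w0] and [b] supports [P], with [P] on the side that
    makes [v0], [w0], [b] anticlockwise seen from outside: for a vertex [b] of a
    face that contains [v0] and [w0], this face is the one on the left of the
    edge from [v0] to [w0]. *)
Definition next_to_first (b : point) : Prop :=
  forall y, P y -> triple (w0 - v0) (b - v0) (y - v0) <= 0.

(** The lexicographic key by which the edge from [a] up to [b] is ranked.  The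
    first component distinguishes, in this order, the edge [v0 w0], the edge from
    [w0] that closes the face on the left of [v0 w0], the other edges at [v0], and
    all the remaining edges; the second one is the height of the lower end where
    it matters; the third one is the opposite of the slope. *)
Definition key (a b : point) : R *l (R *l R) :=
  if (a == v0) && (b == w0) then (0, (0, 0))
  else if (a == w0) && `[< next_to_first b >] then (1, (0, 0))
  else if a == v0 then
    (2, (0, - (triple (b - v0) h0 (w0 - v0) / dot h0 (b - v0))))
  else (3, (dot h a, - (triple (b - a) (v1 - a) (v0 - a) / dot h (b - a)))).

(** The lower and the upper end of a segment that is not horizontal for [h]. *)
Definition lowest (E : set point) : point :=
  xget 0 [set x | E x /\ forall y, E y -> dot h x <= dot h y].

Definition highest (E : set point) : point :=
  xget 0 [set x | E x /\ forall y, E y -> dot h y <= dot h x].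

(** The label of an edge is the rank of its key among the keys of all pairs of
    points of [s]. *)
Definition label (E : set point) : int :=
  (count (fun k => k < key (lowest E) (highest E))%O
     [seq key p.1 p.2 | p <- [seq (a, b) | a <- s, b <- s]])%:Z.

Lemma key_lt (a1 a2 a3 b1 b2 b3 : R) :
  ((a1, (a2, a3)) < (b1, (b2, b3)) :> (R *l (R *l R)))%O =
  (a1 < b1) || (a1 == b1) && ((a2 < b2) || (a2 == b2) && (a3 < b3)).
Proof.
by rewrite !ltxi_pair; case: (ltgtP a1 b1) => //= _; case: (ltgtP a2 b2).
Qed.

Lemma lowest_segment (a b : point) : dot h a < dot h b ->
  lowest (convex_hull [set a; b]) = a.
Proof.
move=> ab; apply: xget_unique => [|x [Ex xmin]].
  split; first by apply: sub_convex_hull; left.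
  move=> y Ey; rewrite -lerN2 -!dotNl; apply: convex_hull_le Ey => z [->|->] //.
  by rewrite !dotNl lerN2 ltW.
apply: (@segment_max R b a (- h)); rewrite ?dotNl ?ltrN2 // 1?setUC // ?lerN2 //.
by apply: xmin; apply: sub_convex_hull; left.
Qed.

Lemma highest_segment (a b : point) : dot h a < dot h b ->
  highest (convex_hull [set a; b]) = b.
Proof.
move=> ab; apply: xget_unique => [|x [Ex xmax]].
  split; first by apply: sub_convex_hull; right.
  by move=> y; apply: convex_hull_le => z [->|->] //; exact: ltW.
by apply: segment_max ab Ex _; apply: xmax; apply: sub_convex_hull; right.
Qed.

Lemma label_lt (a b c d : point) : a \in s -> b \in s ->
  dot h a < dot h b -> dot h c < dot h d -> (key a b < key c d)%O ->
  label (convex_hull [set a; b]) < label (convex_hull [set c; d]).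
Proof.
move=> sa sb ab cd; rewrite /label !lowest_segment // !highest_segment // ltz_nat.
apply: count_lt_rank; apply/mapP; exists (a, b) => //; exact: allpairs_f.
Qed.

Hypothesis dimP : has_affine_dim 3 P.
Hypothesis h_inj : forall x y, x \in s -> y \in s -> dot h x = dot h y -> x = y.
Hypothesis ev0 : exposed s v0.
Hypothesis ew0 : exposed s w0.
Hypothesis h_v0w0 : dot h v0 < dot h w0.
Hypothesis h_w0 : forall x, exposed s x -> x != v0 -> x != w0 -> dot h w0 < dot h x.
Hypothesis h0_v0w0 : dot h0 (w0 - v0) = 0.
Hypothesis h0_v0 : forall x, exposed s x -> x != v0 -> x != w0 ->
  0 < dot h0 (x - v0).
Hypothesis v1s : v1 \in s.
Hypothesis h_v1 : forall x, x \in s -> dot h x <= dot h v1.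

(** The plane of an anticlockwise triangular face [a b c] leaves [P] on its
    negative side and meets it in the face only. *)
Lemma triangle_triple_le (F : set point) n a b c : F = support_face P n ->
  triangle s F n a b c -> forall y, P y ->
  triple (b - a) (c - a) (y - a) <= 0 /\
  (triple (b - a) (c - a) (y - a) = 0 -> F y).
Proof.
move=> hF [_ [Fa Fb Fc] tgt0 _ _] y Py.
have n0 : n != 0 by apply: contraTneq tgt0 => ->; rewrite -dot_cross dotE !mxE /=; lra.
have nF x : F x -> dot n (x - a) = 0.
  by move=> /(iffLR (faceP hF x Fa)) [_ nx]; rewrite dotBr nx subrr.
have := triple_plucker n n (b - a) (c - a) (y - a).
rewrite (nF _ Fb) (nF _ Fc) => e.
have nn := dot_gt0 n0.
have ny : dot n (y - a) <= 0 by rewrite dotBr subr_le0 (face_le hF).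
have {}e : dot n n * triple (b - a) (c - a) (y - a)
    = dot n (y - a) * triple n (b - a) (c - a) by lra.
split.
  by rewrite -(pmulr_rle0 _ nn) e mulr_le0_ge0 // ltW.
move=> T0; apply/(faceP hF _ Fa); split=> //; apply/eqP.
rewrite -subr_eq0 -dotBr; move: e; rewrite T0 mulr0 => /esym/eqP.
by rewrite mulf_eq0 (gt_eqF tgt0) orbF.
Qed.

Lemma exposed_mem x : exposed s x -> x \in s. Proof. by case. Qed.

Lemma exposed_hullP x : exposed s x -> P x.
Proof. by move=> [xs _]; apply: sub_convex_hull. Qed.

(** Comparison of the slopes relative to [g] of two edges [a b] and [a c] of a
    face with vertices [a], [b], [c] in anticlockwise order, where [d - a] is
    an inward direction transverse to the face; the direction [u - a] has to be
    inward too, unless [d - a] is horizontal. *)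
Lemma slope_lt (g a b c u d : point) :
  0 < dot g (b - a) -> 0 < dot g (c - a) -> 0 < dot g (u - a) ->
  dot g (d - a) <= 0 ->
  triple (b - a) (c - a) (d - a) < 0 ->
  dot g (d - a) = 0 \/ triple (b - a) (c - a) (u - a) <= 0 ->
  - (triple (c - a) (u - a) (d - a) / dot g (c - a))
  < - (triple (b - a) (u - a) (d - a) / dot g (b - a)).
Proof.
move=> gb gc gu gd Td Tu.
rewrite ltrN2 ltr_pdivrMr // mulrAC ltr_pdivlMr //.
have := triple_plucker g (b - a) (c - a) (u - a) (d - a).
have : dot g (u - a) * triple (b - a) (c - a) (d - a) < 0 by rewrite nmulr_llt0.
have : 0 <= dot g (d - a) * triple (b - a) (c - a) (u - a).
  by case: Tu => [->|Tu]; [rewrite mul0r|rewrite mulr_le0].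
lra.
Qed.

(** The labels of a triangular face with lowest vertex [a].  Read
    anticlockwise, they increase from the edge [c a], except in the face on the
    left of the edge from [v0] to [w0], where they increase from [a b]. *)
Lemma triangle_labels (F : set point) n a b c : F = support_face P n ->
  triangle s F n a b c -> dot h a < dot h b -> dot h a < dot h c ->
  exists2 vs : seq point, anticlockwise P F n vs
    & sorted <%R [seq label E | E <- sides vs].
Proof.
move=> hF tri hab hac; have Tle := triangle_triple_le hF tri.
have [[ea eb ec] [Fa Fb Fc] tgt0 anti exF] := tri.
have [[sa sb] sc] := (exposed_mem ea, exposed_mem eb, exposed_mem ec).
have bc : b != c by apply: contraTneq tgt0 => ->; rewrite !tripleE; lra.
have hbc : dot h b != dot h c by apply: contra_neq bc => /h_inj; apply.
have Pv0 := exposed_hullP ev0; have Pw0 := exposed_hullP ew0.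
have w0v0 : w0 != v0 by apply: contraTneq h_v0w0 => ->; rewrite ltxx.
have v0_min x : exposed s x -> dot h v0 <= dot h x.
  move=> ex; have [->//|xv0] := eqVneq x v0; have [->|xw0] := eqVneq x w0.
    exact: ltW.
  exact/ltW/(lt_trans h_v0w0)/h_w0.
have not_v0 x : dot h a < dot h x -> x != v0.
  by apply: contraTneq => ->; rewrite -leNgt v0_min.
have bv0 := not_v0 _ hab; have cv0 := not_v0 _ hac.
have sides_abc : anticlockwise P F n [:: c; a; b].
  by have [_ _ _] := triangle_rot (triangle_rot tri).
have [lt02 lt12] : 0 < 2 :> R /\ 1 < 2 :> R by split; lra.
have [lt13 lt23] : 1 < 3 :> R /\ 2 < 3 :> R by split; lra.
(* The order [c a < a b < b c], whichever of [b] and [c] is the lower. *)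
have general : (key a c < key a b)%O ->
    (dot h b < dot h c -> (key a b < key b c)%O) ->
    (dot h c < dot h b -> (key a b < key c b)%O) ->
    exists2 vs : seq point, anticlockwise P F n vs
      & sorted <%R [seq label E | E <- sides vs].
  move=> k1 k2 k3; exists [:: c; a; b]; first exact: sides_abc.
  apply: sorted_sides3; first by rewrite [[set c; a]]setUC; apply: label_lt.
  have [lbc|lcb] := orP (lt_total hbc); first exact: label_lt (k2 lbc).
  by rewrite [[set b; c]]setUC; apply: label_lt (k3 lcb).
have [av0|av0] := eqVneq a v0; last first.
  have nFv0 : ~ F v0.
    move=> /(exF _ ev0); rewrite !inE [v0 == a]eq_sym [v0 == b]eq_sym [v0 == c]eq_sym.
    by rewrite (negPf av0) (negPf bv0) (negPf cv0).
  have Tv0 : triple (b - a) (c - a) (v0 - a) < 0.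
    have [Tv0 Tv0F] := Tle _ Pv0.
    by rewrite lt_neqAle Tv0 andbT; apply/eqP => /Tv0F.
  have above x y : exposed s x -> dot h a < dot h x ->
      key x y = (3, (dot h x, - (triple (y - x) (v1 - x) (v0 - x) / dot h (y - x)))).
    move=> ex hax; rewrite /key (negPf (not_v0 _ hax)) /=.
    suff /negPf -> : x != w0 by [].
    apply: contraTneq hax => ->; rewrite -leNgt.
    by have [->//|aw0] := eqVneq a w0; apply/ltW/h_w0.
  have slopes : - (triple (c - a) (v1 - a) (v0 - a) / dot h (c - a))
      < - (triple (b - a) (v1 - a) (v0 - a) / dot h (b - a)).
    apply: slope_lt; rewrite // ?dotBr ?subr_gt0 ?subr_le0 ?v0_min //.
      exact: lt_le_trans hab (h_v1 sb).
    by right; have [] := Tle v1 (sub_convex_hull v1s).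
  (* Otherwise two distinct faces would lie on the left of the edge from [w0] to
     [b]: this one, and the one that contains [v0]. *)
  have nextb : ~ (a = w0 /\ next_to_first b).
    move=> [aw0 nb]; have := nb _ (exposed_hullP ec); move: Tv0; rewrite aw0.
    by rewrite !tripleE !mxE; lra.
  have keyab : key a b =
      (3, (dot h a, - (triple (b - a) (v1 - a) (v0 - a) / dot h (b - a)))).
    rewrite /key (negPf av0) /=; case: ifP => // /andP [/eqP aw0 /asboolP nb].
    by exfalso; apply: nextb.
  apply: general.
  - rewrite keyab /key (negPf av0) /=; case: ifP => _; rewrite key_lt.
      by rewrite lt13.
    by rewrite !eqxx slopes !orbT.
  - by move=> hbc'; rewrite keyab above // key_lt eqxx hab !orbT.
  - by move=> hcb'; rewrite keyab above // key_lt eqxx hac !orbT.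
subst a.
have key_other x : x != w0 -> key v0 x =
    (2, (0, - (triple (x - v0) h0 (w0 - v0) / dot h0 (x - v0)))).
  by move=> xw0; rewrite /key eqxx (negPf xw0) /= eq_sym (negPf w0v0) //.
have key_v0w0 : key v0 w0 = (0, (0, 0)) by rewrite /key !eqxx.
(* The face on the left of the edge from [v0] to [w0]. *)
have [bw0|bw0] := eqVneq b w0.
  subst b; exists [:: v0; w0; c]; first exact: anti.
  have cw0 : c != w0 by rewrite eq_sym.
  have keyw0c : key w0 c = (1, (0, 0)).
    rewrite /key (negPf w0v0) eqxx /=; case: asboolP => // H; case: H => y Py.
    by case: (Tle _ Py).
  have hw0c : dot h w0 < dot h c by apply: h_w0.
  apply: sorted_sides3.
    by apply: label_lt => //; rewrite keyw0c key_v0w0 key_lt ltr01.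
  rewrite [[set c; v0]]setUC; apply: label_lt => //.
  by rewrite keyw0c key_other // key_lt lt12.
(* The face on the right of the edge from [v0] to [w0]. *)
have [cw0|cw0] := eqVneq c w0.
  subst c; have key_w0b : key w0 b =
     (3, (dot h w0, - (triple (b - w0) (v1 - w0) (v0 - w0) / dot h (b - w0)))).
    rewrite /key (negPf w0v0) eqxx /=; case: asboolP => // nb; exfalso.
    (* Otherwise [P] would lie on both sides of the plane through [v0], [w0]
       and [b], hence in this plane. *)
    have n0 : n != 0 by apply: contraTneq tgt0 => ->; rewrite -dot_cross dotE !mxE /=; lra.
    apply: (affine_dim3_not_planar dimP n0 (c := dot n v0)) => y Py.
    have Fy : F y.
      have [Ty] := Tle _ Py; apply; apply/le_anti; rewrite Ty /=.
      by have := nb _ Py; rewrite !tripleE; lra.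
    by case: (iffLR (faceP hF y Fa) Fy).
  apply: general; rewrite ?key_v0w0 ?key_other // ?key_w0b ?key_lt ?lt02 ?lt23 //.
  by move=> hbw; have := h_w0 eb bv0 bw0; rewrite ltNge (ltW hbw).
have nFw0 : ~ F w0.
  move=> /(exF _ ew0); rewrite !inE [w0 == b]eq_sym [w0 == c]eq_sym.
  by rewrite (negPf w0v0) (negPf bw0) (negPf cw0).
have Tw0 : triple (b - v0) (c - v0) (w0 - v0) < 0.
  have [T T0] := Tle _ Pw0.
  by rewrite lt_neqAle T andbT; apply/eqP => /T0.
have above x y : exposed s x -> x != v0 -> x != w0 -> (key v0 b < key x y)%O.
  move=> ex xv0 xw0; rewrite key_other // /key (negPf xv0) (negPf xw0) /=.
  by rewrite key_lt lt23.
apply: general; [|by move=> _; apply: above..].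
rewrite !key_other // key_lt ltxx eqxx eqxx ltxx /=.
(* As [w0 - v0] is horizontal for [h0], any ascending direction can be used,
   such as [h0] itself. *)
have := @slope_lt h0 v0 b c (h0 + v0) w0; rewrite addrK; apply.
- exact: h0_v0.
- exact: h0_v0.
- by apply: dot_gt0; apply: contraTneq (h0_v0 eb bv0 bw0) => ->; rewrite dot0l ltxx.
- by rewrite h0_v0w0.
- by [].
- by left.
Qed.

Lemma label_coherent : simplicial P -> coherent P label.
Proof.
move=> sP F n faceF hF; have [_ dimF] := faceF.
have n0 := face_normal_neq0 dimP dimF hF.
have [a [b [c tri]]] := simplicial_face_triangle hF n0 dimF (sP _ faceF).
have h_neq x y z : triangle s F n x y z -> dot h x != dot h y.
  move=> [[[xs _] [ys _] _] _ T _ _]; apply: contraTneq T => /(h_inj xs ys) ->.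
  by rewrite !tripleE !mxE; lra.
have tri' := triangle_rot tri; have tri'' := triangle_rot tri'.
have /lt_total/orP [ab|ba] := h_neq _ _ _ tri;
have /lt_total/orP [bc|cb] := h_neq _ _ _ tri';
have /lt_total/orP [ca|ac] := h_neq _ _ _ tri''.
- by move: (lt_trans ab (lt_trans bc ca)); rewrite ltxx.
- exact: triangle_labels hF tri ab ac.
- exact: triangle_labels hF tri'' ca cb.
- exact: triangle_labels hF tri ab ac.
- exact: triangle_labels hF tri' bc ba.
- exact: triangle_labels hF tri' bc ba.
- exact: triangle_labels hF tri'' ca cb.
- by move: (lt_trans ba (lt_trans ac cb)); rewrite ltxx.
Qed.

End Labelling.

(** * The theorem *)

Theorem mainTheorem14 (R : realType) (P : set 'rV[R]_3)
  (hP : convex_polyhedron P) (hS : simplicial P) :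
  coherently_labellable P.
Proof.
have [[A /finite_seqP [s ->] defP] dimP] := hP; rewrite {}defP in hP hS dimP *.
(* Any edge can be used for [v0 w0]; it is obtained from any face. *)
have [[F faceF]|noF] := pselect (exists F, face (convex_hull [set` s]) F);
  last by exists (fun=> 0) => F n faceF; case: noF; exists F.
have [[n hF] dimF] := faceF.
have n0 := face_normal_neq0 dimP dimF hF.
have [x0 Fx0] : exists x, F x by case: dimF => x0 [M [_ Fx0 _ _]]; exists x0.
have [v ev Fv] := face_exposed hF Fx0.
have [w [ew Fw wv [[m hE] _] _]] := next_vertex hF n0 dimF ev Fv.
have [vs _] := ev; have [ws _] := ew.
have Ev : convex_hull [set v; w] v by apply: sub_convex_hull; left.
have Ew : convex_hull [set v; w] w by apply: sub_convex_hull; right.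
have mvw : dot m w = dot m v by case: (iffLR (faceP hE w Ev) Ew).
have m_lt x : exposed s x -> x != v -> x != w -> dot m x < dot m v.
  move=> ex xv xw; have Px : convex_hull [set` s] x.
    by apply: sub_convex_hull; case: ex.
  rewrite lt_neqAle (face_le hE) // andbT; apply/eqP => mx.
  have Ex : convex_hull [set v; w] x by apply/(faceP hE _ Ev).
  have vws y : [set v; w] y -> y \in s by move=> [->|->].
  by case: (exposed_hull ex vws Ex) => /eqP; rewrite ?(negPf xv) ?(negPf xw).
have [h [h_ref h_inj]] := generic_refinement s (- m).
have [v1 v1s h_v1] := exists_argmax (dot h) vs.
have h_gt x y : exposed s x -> x != v -> x != w -> y = v \/ y = w ->
    dot h y < dot h x.
  move=> ex xv xw yvw; apply: h_ref; first by case: yvw => ->.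
    by case: ex.
  by rewrite !dotNl ltrN2; case: yvw => ->; rewrite ?mvw m_lt.
have hvw : dot h v != dot h w.
  by apply: contra_neq wv => /h_inj ->.
have /orP [lvw|lwv] := lt_total hvw.
- exists (label s h (- m) v w v1); apply: label_coherent => //.
  + by move=> x ex xv xw; apply: h_gt; auto.
  + by rewrite dotNl dotBr mvw subrr oppr0.
  + by move=> x ex xv xw; rewrite dotNl dotBr oppr_gt0 subr_lt0 m_lt.
- exists (label s h (- m) w v v1); apply: label_coherent => //.
  + by move=> x ex xw xv; apply: h_gt; auto.
  + by rewrite dotNl dotBr mvw subrr oppr0.
  + by move=> x ex xw xv; rewrite dotNl dotBr oppr_gt0 subr_lt0 mvw m_lt.
Qed.
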